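(* Let $1\le q\le 2$ and $h_q=2^q-2$. For all $s,t\ge 0$, \[ (s+t)^q\le s^q+t^q+h_q(st)^{q/2}. \] The coefficient $h_q$ is sharp (it cannot be replaced by a smaller constant). If $1<q<2$ and $s,t>0$, equality holds precisely when $s=t$. *)

(* Defs.v *)
From HB Require Import structures.
From mathcomp Require Import all_boot all_order all_algebra.
From mathcomp Require Import reals exp.

Set Implicit Arguments.
Unset Strict Implicit.
Unset Printing Implicit Defensive.

Import GRing.Theory Num.Theory.
Local Open Scope ring_scope.

Definition hcoef (R : realType) (q : R) : R := 2 `^ q - 2.

(* Main.v *)
(** Put s = m e^x and t = m e^-x: the inequality becomes
    (2 cosh x)^q <= 2 cosh (q x) + 2^q - 2, an equality at x = 0. The difference
    of the two sides is strictly monotone in x > 0 when 1 < q < 2: comparing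
    derivatives, this is (2 cosh x)^(q-1) * 2 sinh x < 2 sinh (q x), which for
    w = e^(-2x) reads (1 + w)^(q-1) (1 - w) < 1 - w^q and follows from Bernoulli's
    inequality applied to (1 + w)^(q-1) and to w^(q-1). *)
Require Import Defs.
From mathcomp Require Import all_boot all_order all_algebra.
From mathcomp Require Import reals exp.
From mathcomp Require Import topology normedtype sequences derive realfun.
From mathcomp Require Import ring lra.

Set Implicit Arguments.
Unset Strict Implicit.
Unset Printing Implicit Defensive.

Import Order.TTheory GRing.Theory Num.Theory.
Import numFieldNormedType.Exports.
Local Open Scope ring_scope.

(** Strictness comes from [1 + y < expR y] for nonzero [y], taken at [y = ln x]. *)
Lemma ln_lt_subr1 (R : realType) (x : R) : 0 < x -> x != 1 -> ln x < x - 1.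
Proof.
move=> x0 x1.
have lnx : ln x != 0 by apply: contra x1 => /eqP l0; rewrite -[x]lnK// l0 expR0.
by have := expR_gt1Dx lnx; rewrite lnK//; lra.
Qed.

Lemma powR_lt_bernoulli (R : realType) (p u : R) :
  0 < p -> p < 1 -> -1 < u -> u != 0 -> (1 + u) `^ p < 1 + p * u.
Proof.
move=> p0 p1 u1 u0.
have u1' : 0 < 1 + u by lra.
have A0 : 0 < 1 + p * u by nra.
have pu0 : p * u != 0 by rewrite mulf_neq0// gt_eqF.
have A1 : 1 + p * u != 1 by apply: contra pu0 => /eqP ?; apply/eqP; lra.
(* Weighted AM-GM: combine [ln z < z - 1] at [z = 1/A] and [z = (1+u)/A],
   where A = 1 + p u, with weights 1-p and p. *)
have := @ln_lt_subr1 _ (1 + p * u)^-1; rewrite invr_gt0 invr_eq1 => /(_ A0 A1).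
have := @ln_lt_subr1 _ ((1 + u) / (1 + p * u)).
rewrite divr_gt0//; have B1 : (1 + u) / (1 + p * u) != 1.
  rewrite -subr_eq0; have -> : (1 + u) / (1 + p * u) - 1 = (1 - p) * u / (1 + p * u).
    by field; rewrite gt_eqF.
  by rewrite !mulf_neq0 ?invr_eq0 ?subr_eq0 ?[1 == p]gt_eqF ?[1 + _ == 0]gt_eqF.
move=> /(_ isT B1); rewrite ln_div ?posrE// lnV ?posrE//.
set a := ln (1 + u); set b := ln (1 + p * u) => h1 h2.
(* The weighted upper bounds cancel, so [h1] and [h2] combine to [p * a - b < 0]. *)
have e : (1 - p) * ((1 + p * u)^-1 - 1) + p * ((1 + u) / (1 + p * u) - 1) = 0.
  by field; rewrite gt_eqF.
rewrite -ltr_ln ?posrE ?powR_gt0// ln_powR -/a -/b.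
by nra.
Qed.

Lemma sinh_cosh_lt (R : realType) (q x : R) : 1 < q -> q < 2 -> 0 < x ->
  (expR x + expR (- x)) `^ (q - 1) * (expR x - expR (- x)) <
  expR (q * x) - expR (- (q * x)).
Proof.
move=> q1 q2 x0.
set w := expR (- (2 * x)).
have w0 : 0 < w by exact: expR_gt0.
have w1 : w < 1 by rewrite -expR0 ltr_expR; lra.
have B1 : (1 + w) `^ (q - 1) < 1 + (q - 1) * w.
  by apply: powR_lt_bernoulli; rewrite ?gt_eqF//; lra.
have B2 : w `^ (q - 1) < 1 + (q - 1) * (w - 1).
  rewrite -[X in X `^ _](addrNK 1) addrC.
  by apply: powR_lt_bernoulli; rewrite ?lt_eqF//; lra.
(* Both sides share the positive factor [E], which is e^(q x); what remains involves [w] alone. *)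
have eN : expR (- x) = expR x * w by rewrite -expRD; congr expR; lra.
have -> : expR x + expR (- x) = expR x * (1 + w) by rewrite eN; ring.
have -> : expR x - expR (- x) = expR x * (1 - w) by rewrite eN; ring.
have -> : expR (- (q * x)) = expR (q * x) * (w * w `^ (q - 1)).
  by rewrite -expRM -!expRD; congr expR; lra.
rewrite powRM ?expR_ge0//; last lra.
have -> : expR (q * x) = expR x `^ (q - 1) * expR x.
  by rewrite -expRM -expRD; congr expR; lra.
rewrite -subr_gt0.
set E := expR x `^ (q - 1) * expR x.
have E0 : 0 < E by rewrite mulr_gt0 ?powR_gt0 ?expR_gt0.
rewrite [X in 0 < X](_ : _ =
  E * ((1 - w * w `^ (q - 1)) - (1 + w) `^ (q - 1) * (1 - w))); last first.
  by rewrite /E; move: (expR x) (_ `^ _) (_ `^ _) (_ `^ _) => *; ring.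
rewrite mulr_gt0// subr_gt0.
(* Both sides are separated by [(1 - w) (1 + (q - 1) w)]. *)
apply: (@lt_trans _ _ ((1 - w) * (1 + (q - 1) * w))); first by nra.
(* This is [B2] times [w]: [1 - w * (1 + (q - 1) * (w - 1))] equals the separating product. *)
by nra.
Qed.

Lemma powR_cosh_lt (R : realType) (q x : R) : 1 < q -> q < 2 -> 0 < x ->
  (expR x + expR (- x)) `^ q < expR (q * x) + expR (- (q * x)) + hcoef q.
Proof.
move=> q1 q2 x0.
pose F (y : R) := expR (q * y) + expR (- (q * y)) - (expR y + expR (- y)) `^ q.
pose dF (y : R) := q * (expR (q * y) - expR (- (q * y)) -
  (expR y + expR (- y)) `^ (q - 1) * (expR y - expR (- y))).
have FdF (y : R) : is_derive y 1 F (dF y).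
  have c0 : 0 < expR y + expR (- y) by rewrite addr_gt0 ?expR_gt0.
  have dc : is_derive y 1 (fun y : R => expR y + expR (- y)) (expR y - expR (- y)).
    by apply: is_derive_eq; rewrite mulrN1.
  have dp := @is_derive1_comp _ (fun z : R => z `^ q)
    (fun y : R => expR y + expR (- y)) y _ _ (is_derive1_powR q c0) dc.
  rewrite /F /dF.
  by apply: is_derive_eq; rewrite [q%:A]mulr1 /=; ring.
(* The point [c] is interior, so [0 < c]; at 0 itself [dF] vanishes. *)
have [|c] := @MVT _ F dF 0 x x0 (fun y _ => FdF y).
  apply: continuous_subspaceT => y.
  by apply: differentiable_continuous; apply/derivable1_diffP.
rewrite in_itv/= => /andP[c0 _] Fx.
have dFc : 0 < dF c.
  by rewrite mulr_gt0 ?(lt_trans _ q1)// subr_gt0 sinh_cosh_lt.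
(* Since [F 0 = 2 - 2^q = - hcoef q], this positivity is the claim. *)
have : 0 < F x - F 0 by rewrite Fx subr0 mulr_gt0.
move=> {FdF dFc Fx dF}; rewrite /F /hcoef mulr0 oppr0 expR0 -mulr2n => {F}.
by move: (_ `^ _) (_ `^ _) (expR _) (expR _) => *; lra.
Qed.

Lemma powRD_lt (R : realType) (q s t : R) : 1 < q -> q < 2 ->
  0 < s -> 0 < t -> s != t ->
  (s + t) `^ q < s `^ q + t `^ q + hcoef q * (s * t) `^ (q / 2).
Proof.
move=> q1 q2.
wlog ts : s t / t < s.
  move=> H s0 t0 st; have [ts|st'|e] := ltgtP t s.
  - exact: H.
  - by rewrite addrC [s * t]mulrC [s `^ q + _]addrC; apply: H; rewrite // eq_sym.
  - by rewrite e eqxx in st.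
move=> s0 t0 _.
(* Here [expR m] is the geometric mean of [s] and [t], and [expR x] is the square root of [s / t].
   By homogeneity [expR m] to the power [q] factors out. *)
pose m := (ln s + ln t) / 2; pose x := (ln s - ln t) / 2.
have x0 : 0 < x by rewrite divr_gt0// subr_gt0 ltr_ln.
have sE : s = expR m * expR x by rewrite -expRD -[LHS]lnK//; congr expR; rewrite /m /x; lra.
have tE : t = expR m * expR (- x) by rewrite -expRD -[LHS]lnK//; congr expR; rewrite /m /x; lra.
have -> : (s * t) `^ (q / 2) = expR m `^ q.
  by rewrite -[s]lnK// -[t]lnK// -expRD -!expRM; congr expR; rewrite /m; lra.
rewrite sE tE -mulrDr !powRM ?addr_ge0 ?expR_ge0// -!mulrDr.
rewrite [hcoef q * _]mulrC -mulrDr ltr_pM2l ?powR_gt0 ?expR_gt0//.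
have := powR_cosh_lt q1 q2 x0.
by rewrite -!expRM mulNr ![x * q]mulrC.
Qed.

Theorem lemma2p1 (R : realType) (q : R) (hq1 : 1 <= q) (hq2 : q <= 2) :
  (forall s t : R, 0 <= s -> 0 <= t ->
     (s + t) `^ q <= s `^ q + t `^ q + hcoef q * (s * t) `^ (q / 2)) /\
  (forall c : R, c < hcoef q ->
     ~ (forall s t : R, 0 <= s -> 0 <= t ->
          (s + t) `^ q <= s `^ q + t `^ q + c * (s * t) `^ (q / 2))) /\
  (1 < q -> q < 2 -> forall s t : R, 0 < s -> 0 < t ->
     ((s + t) `^ q = s `^ q + t `^ q + hcoef q * (s * t) `^ (q / 2) <-> s = t)).
Proof.
(* Equality on the diagonal serves the case [s = t], sharpness and the equality clause. *)
have diag (s : R) : 0 <= s ->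
    (s + s) `^ q = s `^ q + s `^ q + hcoef q * (s * s) `^ (q / 2).
  move=> s0; have -> : (s * s) `^ (q / 2) = s `^ q.
    rewrite powRM// -powRD; first by rewrite -splitr.
    by rewrite -splitr gt_eqF//; lra.
  have -> : s + s = 2 * s by ring.
  by rewrite powRM// /hcoef; ring.
split; [|split].
- move=> s t s0 t0.
  (* Both endpoints give identities: [hcoef 1 = 0], and [hcoef 2 = 2] yields the binomial square. *)
  have [-> | q1] := eqVneq q 1.
    rewrite /hcoef (powRr1 (addr_ge0 s0 t0)) (powRr1 s0) (powRr1 t0).
    by rewrite (powRr1 (ler0n R 2)) subrr mul0r addr0.
  have [-> | q2] := eqVneq q 2.
    rewrite /hcoef divff ?pnatr_eq0// powRr1 ?mulr_ge0// !powR_mulrn ?addr_ge0//.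
    by rewrite le_eqVlt; apply/orP; left; apply/eqP; ring.
  (* As 0 to the power 0 is 1, powers of 0 vanish only for nonzero exponents. *)
  have q0 : q != 0 by apply/eqP; lra.
  have q20 : q / 2 != 0 by apply/eqP; lra.
  have [-> | sn0] := eqVneq s 0.
    by rewrite mul0r !powR0// add0r mulr0 add0r addr0.
  have [-> | tn0] := eqVneq t 0.
    by rewrite mulr0 !powR0// mulr0 !addr0.
  have [<- | st] := eqVneq s t; first by rewrite diag.
  have q_gt1 : 1 < q by rewrite lt_def q1.
  have q_lt2 : q < 2 by rewrite lt_neqAle q2.
  have s_gt0 : 0 < s by rewrite lt_def sn0.
  have t_gt0 : 0 < t by rewrite lt_def tn0.
  exact/ltW/powRD_lt.
(* At [s = t = 1], [diag] turns the assumed bound into [hcoef q <= c]. *)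
- move=> c ch /(_ 1 1 ler01 ler01).
  by rewrite diag// !mulr1 !powR1 lerD2l !mulr1 leNgt ch.
- move=> q1 q2 s t s0 t0; split=> [e | <-]; last exact: diag (ltW s0).
  apply/eqP; apply: contraT => st.
  by have := powRD_lt q1 q2 s0 t0 st; rewrite e ltxx.
Qed.
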